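(* Let $k\ge 1$ and $n\ge 1$ be integers, let $T$ be a $(k+1)$-ary increasing tree of size $n$, and let $\sigma=\sigma_1\cdots\sigma_{kn}$ be the $k$-Stirling permutation of size $n$ obtained from $T$ by the depth-first-walk coding described in the context. Then for every $i$ with $1\le i\le n$, the local type of $i$ in $\sigma$ equals the node type of the node labelled $i$ in $T$, i.e. $L_i(\sigma)=G_i(T)$.
   Context: A $k$-Stirling permutation of size $n$ is a permutation (word) of the multiset $\{1^k,2^k,\dots,n^k\}$ such that for each $i$, all entries occurring between two occurrences of $i$ are at least $i$. A $(k+1)$-ary increasing tree of size $n$ is a rooted tree on the node set $\{1,\dots,n\}$ in which each node has $k+1$ distinguishable child positions (ordered left to right), each either occupied by a child node or vacant (a vacant position is called an external node), and labels increase along every path from the root (so the root is $1$). Coding: in each internal node $v$, between its $k+1$ consecutive outgoing positions place $k$ copies of the label $v$; perform the depth-first (contour) walk starting at the root, visiting the child positions left to right, and record a label $v$ each of the $k$ times the walk returns to $v$ between two consecutive child positions (not on first arrival and not on final departure); external nodes contribute nothing. The resulting word of length $kn$ is a $k$-Stirling permutation, and this coding is a bijection. Node type: $G_i(T)=g_{i,1}\cdots g_{i,k+1}\in\{0,1\}^{k+1}$, where $g_{i,h}=1$ if the $h$-th child position (from the left) of node $i$ is occupied by a node and $g_{i,h}=0$ otherwise. Local type: for a $k$-Stirling permutation $\sigma=\sigma_1\cdots\sigma_{kn}$ use boundary conventions $\sigma_0=\sigma_{kn+1}=-\infty$, and let $j_{i,1}<\dots<j_{i,k}$ be the positions with $\sigma_{j_{i,h}}=i$.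 Then $L_i(\sigma)=\ell_{i,1}\cdots\ell_{i,k+1}\in\{0,1\}^{k+1}$ where $\ell_{i,1}=0$ if $\sigma_{j_{i,1}-1}<\sigma_{j_{i,1}}$ and $\ell_{i,1}=1$ if $\sigma_{j_{i,1}-1}>\sigma_{j_{i,1}}$; $\ell_{i,k+1}=0$ if $\sigma_{j_{i,k}}>\sigma_{j_{i,k}+1}$ and $\ell_{i,k+1}=1$ if $\sigma_{j_{i,k}}<\sigma_{j_{i,k}+1}$; and for $2\le h\le k$, $\ell_{i,h}=0$ if $\sigma_{j_{i,h}-1}=\sigma_{j_{i,h}}$ and $\ell_{i,h}=1$ otherwise. *)

(* Defs.v *)
From mathcomp Require Import all_boot.

Set Implicit Arguments.
Unset Strict Implicit.
Unset Printing Implicit Defensive.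

(* Bits 0 and 1 are [false] and [true]; the child positions and the letters of
   a type, numbered 1, ..., k+1 from left to right, are indexed by 'I_k.+1,
   hence shifted by one. *)

Section Trees.

Variable k : nat.

(* [Ext] is a vacant child position (an external node). *)
Inductive tree : Type :=
  | Ext
  | Node of nat & {ffun 'I_k.+1 -> tree}.

Definition occupied (T : tree) : bool := if T is Node _ _ then true else false.

Definition label (T : tree) : option nat :=
  if T is Node v _ then Some v else None.

Definition child (T : tree) (h : 'I_k.+1) : tree :=
  if T is Node _ c then c h else Ext.

(* The subtrees rooted at the internal nodes of [T], in preorder. *)
Fixpoint subtrees (T : tree) : seq tree :=
  if T is Node v c then
    Node v c :: flatten [seq subtrees (c h) | h <- enum 'I_k.+1]
  else [::].

Definition labels (T : tree) : seq nat := pmap label (subtrees T).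

(* Every path going down from the root of [T] has strictly increasing labels,
   all of them greater than [a] when [a] is [Some] parent label. *)
Fixpoint increasing_below (a : option nat) (T : tree) : Prop :=
  if T is Node v c then
    (if a is Some u then u < v else true) /\
    forall h, increasing_below (Some v) (c h)
  else True.

Definition increasing_tree (n : nat) (T : tree) : Prop :=
  perm_eq (labels T) (iota 1 n) /\ increasing_below None T.

(* The visits of the contour walk to internal nodes: [(v, j)] is the visit to
   [v] made when exactly [j] of its child positions have been explored, so that
   [j = 0] is the first arrival and [j = k.+1] the final departure. *)
Fixpoint contour (T : tree) : seq (nat * nat) :=
  if T is Node v c then
    (v, 0) :: flatten [seq rcons (contour (c h)) (v, h.+1) | h <- enum 'I_k.+1]
  else [::].

Definition coding (T : tree) : seq nat :=
  [seq p.1 | p <- contour T & 1 <= p.2 <= k].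

(* The subtree rooted at the node labelled [i] ([Ext] if there is none). *)
Definition node (T : tree) (i : nat) : tree :=
  nth Ext (subtrees T) (index i (labels T)).

Definition node_type (T : tree) (i : nat) : k.+1.-tuple bool :=
  [tuple occupied (child (node T i) h) | h < k.+1].

End Trees.

Arguments Ext {k}.

(* The letter s_j of a word s_1 ... s_m, extended by -oo, encoded as [None],
   at the positions 0 and m+1. *)
Definition entry (s : seq nat) (j : nat) : option nat :=
  if 1 <= j <= size s then Some (nth 0 s j.-1) else None.

Definition entry_lt (x y : option nat) : bool :=
  match x, y with
  | None, Some _ => true
  | Some a, Some b => a < b
  | _, None => false
  end.

(* The increasing sequence j_{i,1} < j_{i,2} < ... of the (1-based) positions
   of [i] in [s]. *)
Definition positions (s : seq nat) (i : nat) : seq nat :=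
  [seq j <- iota 1 (size s) | entry s j == Some i].

(* At the first (last) occurrence of [i] the preceding (following) entry differs
   from [i], so the two strict comparisons below decide the extreme letters.
   Only meaningful for [k > 0] and [k] occurrences of [i] in [s]. *)
Definition local_type (k : nat) (s : seq nat) (i : nat) : k.+1.-tuple bool :=
  let pos h := nth 0 (positions s i) h.-1 in (* j_{i,h}, for 1 <= h <= k *)
  [tuple
     if h == 0 :> nat then
       entry_lt (entry s (pos 1)) (entry s (pos 1).-1)
     else if h == k :> nat then
       entry_lt (entry s (pos k)) (entry s (pos k).+1)
     else entry s (pos h.+1).-1 != entry s (pos h.+1)
   | h < k.+1].

(* Main.v *)
(* The subtree rooted at i codes to W_0 i W_1 i ... i W_k, where W_h is the coding
   of the h-th child: it is empty exactly when that position is vacant, and all of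
   its letters exceed i. This word is a factor of the coding of T; it contains all
   the occurrences of i, and each of its outer neighbours is the label of a proper
   ancestor, hence less than i, or missing. *)
Require Import Defs.
From mathcomp Require Import all_boot.

(** Dual to [ohead]: the empty word yields [None], which is also the value of [entry] at the
    boundary. *)
Definition olast (s : seq nat) : option nat := ohead (rev s).

Lemma olast_cat s1 s2 :
  olast (s1 ++ s2) = if s2 is [::] then olast s1 else olast s2.
Proof.
rewrite /olast rev_cat; case: s2 => [|x s2] //.
by case E: (rev (x :: s2)) => //; move/(congr1 size): E; rewrite size_rev.
Qed.

Lemma olast_rcons s x : olast (rcons s x) = Some x.
Proof. by rewrite /olast rev_rcons. Qed.

Lemma olast_all (P : pred nat) s :
  s != [::] -> all P s -> exists2 x, olast s = Some x & P x.
Proof.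
case/lastP: s => // s x _; rewrite all_rcons => /andP[Px _].
by exists x; rewrite ?olast_rcons.
Qed.

Lemma entry_size_cat s1 s2 : entry (s1 ++ s2) (size s1) = olast s1.
Proof.
case/lastP: s1 => [|s1 x]; first by rewrite /entry.
rewrite olast_rcons /entry size_cat size_rcons leq_addr /=.
by rewrite nth_cat size_rcons ltnSn nth_rcons ltnn eqxx.
Qed.

Lemma entry_sizeS_cat s1 s2 : entry (s1 ++ s2) (size s1).+1 = ohead s2.
Proof.
rewrite /entry size_cat -[(size s1).+1]addn1 leq_add2l addn1 /= nth_cat ltnn subnn.
by case: s2.
Qed.

(** Finds j_{i,h} by counting: the occurrences of [i] inside [s1] fill the first [count_mem i s1]
    places of [positions], and the displayed [i] comes next. *)
Lemma nth_positions s1 i s2 :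
  nth 0 (positions (s1 ++ i :: s2) i) (count_mem i s1) = (size s1).+1.
Proof.
have count_pos :
    count (fun j => entry (s1 ++ i :: s2) j == Some i) (iota 1 (size s1))
    = count_mem i s1.
  rewrite -[in RHS](mkseq_nth 0 s1) /mkseq count_map (iotaDl 1 0) count_map.
  apply: eq_in_count => j; rewrite mem_iota /= => lt_j.
  by rewrite /entry size_cat add1n /= nth_cat lt_j ltn_addr.
rewrite /positions size_cat iotaD filter_cat nth_cat size_filter count_pos.
by rewrite ltnn subnn /= add1n entry_sizeS_cat eqxx.
Qed.

Section Coding.

Variable k : nat.
Implicit Types (T S : tree k) (c : {ffun 'I_k.+1 -> tree k}).

Fixpoint tree_nested_ind (P : tree k -> Prop) (PExt : P Ext)
    (PNode : forall v c, (forall h, P (c h)) -> P (Node v c)) T : P T :=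
  match T with
  | Ext => PExt
  | Node v c => PNode v c (fun h => tree_nested_ind P PExt PNode (c h))
  end.

(** The visit to [v] after child [h] has number [h.+1], which the filter keeps exactly when [h < k];
    the first arrival, numbered 0, is dropped. *)
Lemma coding_Node v c :
  coding (Node v c) =
  flatten [seq coding (c h) ++ nseq (h < k) v | h : 'I_k.+1].
Proof.
rewrite /coding /= filter_flatten map_flatten -2!map_comp; congr flatten.
apply: eq_map => h /=; rewrite filter_rcons /=.
by case: (h < k); rewrite ?map_rcons ?cats1 ?cats0.
Qed.

Lemma mem_coding_Node v c x :
  x \in coding (Node v c) -> x = v \/ exists h, x \in coding (c h).
Proof.
rewrite coding_Node => /flattenP[s /mapP[h _ ->]].
rewrite mem_cat => /orP[xh | ]; first by right; exists h.
by rewrite mem_nseq => /andP[_ /eqP->]; left.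
Qed.

(** Cuts W_0 v W_1 v ... v W_k around W_h. The count in [p] tells which occurrence of [v] stands
    next to W_h. *)
Lemma coding_Node_split v c (h : 'I_k.+1) : exists p q,
  [/\ coding (Node v c) = p ++ coding (c h) ++ q,
      olast p = if h == 0 :> nat then None else Some v,
      ohead q = if h == k :> nat then None else Some v
    & (forall j, v \notin coding (c j)) -> count_mem v p = h].
Proof.
(* [F m] is W_m with the [v] that follows it, if any; indexing by naturals lets the range be cut
   with [iota]. *)
pose F m := coding (c (inord m)) ++ nseq (m < k) v.
have ltF m : m < k -> F m = rcons (coding (c (inord m))) v.
  by rewrite /F => ->; rewrite cats1.
exists (flatten [seq F m | m <- iota 0 h]).
exists (nseq (h < k) v ++ flatten [seq F m | m <- iota h.+1 (k - h)]).
have le_hk : h <= k by rewrite -ltnS.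
split.
- rewrite coding_Node.
  have -> : [seq coding (c h) ++ nseq (h < k) v | h : 'I_k.+1]
            = [seq F m | m <- iota 0 k.+1].
    rewrite -val_enum_ord -map_comp; apply: eq_map => j /=.
    by rewrite /F inord_val.
  rewrite -[in iota 0 k.+1](subnKC le_hk) -addnS iotaD /= map_cat flatten_cat /=.
  by rewrite /F inord_val -catA.
- case: (h : nat) le_hk => [|m] lt_mk //.
  rewrite -[in iota 0 _]addn1 iotaD map_cat flatten_cat /= cats0 add0n ltF //.
  by rewrite -rcons_cat olast_rcons.
- case: eqVneq => [-> | ne_hk]; first by rewrite ltnn subnn.
  by rewrite ltn_neqAle ne_hk le_hk.
(* Each of the [h] blocks before W_h contributes only its final [v]. *)
move=> v_notin; rewrite count_flatten -map_comp.
have /eq_in_map-> : {in iota 0 h, count_mem v \o F =1 fun=> 1}.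
  move=> m; rewrite mem_iota /= => lt_mh; rewrite ltF ?(leq_trans lt_mh) //.
  by rewrite -cats1 count_cat /= eqxx; move/count_memPn: (v_notin (inord m)) => ->.
by rewrite sumnE big_map sum1_size size_iota.
Qed.

Lemma all_label_subtrees T : all (isSome \o @label k) (subtrees T).
Proof.
elim/tree_nested_ind: T => //= v c IH.
by elim: (enum _) => //= h s IHs; rewrite all_cat IH.
Qed.

(** Every listed subtree is internal, so [pmap] drops nothing and indices in [labels] and [subtrees]
    agree. *)
Lemma map_Some_labels T : map Some (labels T) = map (@label k) (subtrees T).
Proof.
by rewrite /labels pmapS_filter (all_filterP (all_label_subtrees T)).
Qed.

Lemma count_mem_labels T i :
  count_mem i (labels T) = count (fun S => label S == Some i) (subtrees T).
Proof.
transitivity (count_mem (Some i) (map Some (labels T))).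
  by rewrite count_map; apply: eq_count.
by rewrite map_Some_labels count_map; apply: eq_count.
Qed.

Lemma count_mem_coding T i : count_mem i (coding T) = k * count_mem i (labels T).
Proof.
rewrite count_mem_labels; elim/tree_nested_ind: T => [|v c IH]; first by rewrite muln0.
rewrite coding_Node /= !count_flatten !sumnE.
rewrite [in LHS]big_map [in LHS]big_image 2![in RHS]big_map big_enum /=.
rewrite mulnDr big_distrr /=.
under eq_bigr => h _ do rewrite count_cat IH count_nseq /=.
rewrite big_split /= addnC; congr (_ + _).
rewrite -big_distrr /= mulnC; congr (_ * _).
(* No copy of [v] follows the last child, which leaves [k] copies. *)
rewrite big_ord_recr /= ltnn addn0.
by rewrite (eq_bigr (fun=> 1)) ?sum1_card ?card_ord // => h _; rewrite ltn_ord.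
Qed.

Lemma nodeE T i : i \in labels T ->
  exists2 j, j < size (subtrees T) & exists c,
    node T i = Node i c /\ nth Ext (subtrees T) j = Node i c.
Proof.
move=> iT; have lt_j : index i (labels T) < size (labels T) by rewrite index_mem.
have size_eq : size (labels T) = size (subtrees T).
  by have:= congr1 size (map_Some_labels T); rewrite !size_map.
exists (index i (labels T)); first by rewrite -size_eq.
have: label (node T i) = Some i.
  rewrite /node -(nth_map _ None) -?size_eq // -map_Some_labels.
  by rewrite (nth_map 0) // nth_index.
by rewrite /node; case: nth => //= u c [->]; exists c.
Qed.

Hypothesis k_gt0 : 0 < k.

(** As [0 < k], a copy of [v] follows W_0. *)
Lemma label_in_coding v c : v \in coding (Node v c).
Proof.
have [p [q [-> _ /= q_head _]]] := coding_Node_split v c ord0.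
move: q_head; rewrite (ltn_eqF k_gt0); case: q => //= _ q [->].
by rewrite !mem_cat mem_head !orbT.
Qed.

Lemma coding_eq_nil T : (coding T == [::]) = ~~ occupied T.
Proof. by case: T => //= v c; case: coding (label_in_coding v c). Qed.

Lemma coding_gt a T : increasing_below (Some a) T -> all (ltn a) (coding T).
Proof.
elim/tree_nested_ind: T a => //= v c IH a [lt_av inc].
apply/allP => x /mem_coding_Node[-> // | [h xh]].
exact: ltn_trans lt_av (allP (IH h v (inc h)) x xh).
Qed.

(** Induction on the tree, with [a] and the preorder index [j] arbitrary so that the hypothesis
    applies to the child containing the subtree. The outer neighbours come from that child's word
    or, where its [p] or [q] is empty, from the parent's label or the boundary. *)
Lemma coding_subtree_split a T j i c :
    increasing_below a T -> j < size (subtrees T) ->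
    nth Ext (subtrees T) j = Node i c ->
  (exists p q,
    [/\ coding T = p ++ coding (Node i c) ++ q,
        entry_lt (olast p) (Some i) & entry_lt (ohead q) (Some i)])
  /\ increasing_below None (Node i c).
Proof.
elim/tree_nested_ind: T a j => //= v c' IH a [|j] [_ inc] /=.
  by move=> _ [<- <-]; split=> //; exists [::], [::]; rewrite cats0.
rewrite ltnS size_flatten nth_flatten.
(* Index [j] in the flattened list is an offset inside the list of child [m]. *)
set ss := [seq _ | h <- _]; set m := reshape_index _ _ => lt_j.
have lt_m : m < size ss.
  by have := reshape_indexP lt_j; rewrite size_map.
have lt_o := reshape_offsetP lt_j; move: lt_o; rewrite nth_shape -/m.
have lt_mk : m < size (enum 'I_k.+1) by move: lt_m; rewrite size_map.
rewrite (nth_map ord0) //; set h := nth ord0 _ _ => lt_o nth_o.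
have [[p [q [Epq lt_p lt_q]]] incS] := IH h _ _ (inc h) lt_o nth_o.
split=> //.
have [p' [q' [Epq' p'v q'v _]]] := coding_Node_split v c' h.
(* [i] occurs in the word of child [h], all of whose letters exceed [v]. *)
have lt_vi : v < i.
  have /allP := coding_gt v _ (inc h); apply.
  by rewrite Epq !mem_cat label_in_coding orbT.
exists (p' ++ p), (q ++ q'); split.
- by rewrite Epq' Epq -!catA.
- by rewrite olast_cat; case: p lt_p {Epq} => // _; rewrite p'v; case: ifP.
- by case: q lt_q {Epq} => //= _; rewrite q'v; case: ifP.
Qed.

End Coding.

Theorem theorem3 (k n : nat) (hk : 1 <= k) (hn : 1 <= n)
    (T : tree k) (hT : increasing_tree n T)
    (i : nat) (hi : 1 <= i <= n) :
  local_type k (coding T) i = node_type T i.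
Proof.
have [perm_T inc_T] := hT.
have iT : i \in labels T by rewrite (perm_mem perm_T) mem_iota add1n ltnS.
have count_i : count_mem i (coding T) = k.
  rewrite count_mem_coding count_uniq_mem ?iT ?muln1 //.
  by rewrite (perm_uniq perm_T) iota_uniq.
have [j lt_j [c [Enode Enth]]] := nodeE k T i iT.
have [[P [Q [ET lt_P lt_Q]]] [_ inc_c]] :=
  coding_subtree_split k hk None T j i c inc_T lt_j Enth.
have gt_c h : all (ltn i) (coding (c h)) by apply: coding_gt (inc_c h).
have i_notin h : i \notin coding (c h).
  by apply/negP => /(allP (gt_c h)) /=; rewrite ltnn.
(* The factor coded by the subtree already holds all [k] copies of [i], so occurrences in it keep
   their rank in the whole word. *)
have count_P : count_mem i P = 0.
  have le_k : k <= count_mem i (coding (Node i c)).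
    rewrite count_mem_coding leq_pmulr // -has_count has_pred1.
    by rewrite inE eqxx.
  move: count_i; rewrite ET !count_cat => count_i.
  apply/eqP; rewrite -leqn0 -(leq_add2r k) add0n -[leqRHS]count_i leq_add2l.
  exact: leq_trans le_k (leq_addr _ _).
apply: eq_from_tnth => h; rewrite !tnth_mktuple Enode /= -(negbK (occupied _)).
rewrite -coding_eq_nil //.
have [p [q [Ec p_last q_head /(_ i_notin) count_p]]] := coding_Node_split k i c h.
(* First letter: [p] is empty and j_{i,1} comes right after [P] and W_0. Its left neighbour is the
   last letter of W_0, or that of [P] if W_0 is empty. *)
rewrite ET {}Ec; case: ifP => [h0 | hN0].
  move: p_last q_head; rewrite h0 (eqP h0) (ltn_eqF hk).
  case/lastP: p count_p => [|p x] count_p; last by rewrite olast_rcons.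
  case: q => //= _ q _ [->].
  rewrite -!catA catA.
  have := nth_positions (P ++ coding (c h)) i (q ++ Q).
  rewrite count_cat count_P (count_memPn (i_notin h)) addn0 => ->.
  rewrite entry_size_cat entry_sizeS_cat /= olast_cat.
  case E: coding => [|x s].
    by case: olast lt_P => //= x; case: ltngtP.
  rewrite -E; have [|y -> /=] := olast_all _ _ _ (gt_c h); first by rewrite E.
  by rewrite E => ->.
have {}p_last : olast p = Some i by rewrite p_last hN0.
(* Last letter: [q] is empty and the final [i] of [p] is occurrence [k], preceded by [k.-1]
   others. *)
case: ifP => [hk' | hNk].
  move: q_head; rewrite hk'; case: q => //= _.
  case/lastP: p p_last count_p => [|p x] //; rewrite olast_rcons => -[->].
  rewrite (eqP hk') -cats1 count_cat /= eqxx addn0 addn1.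
  move=> /(congr1 predn) /= count_p.
  rewrite cats0 -!catA /= catA.
  have := nth_positions (P ++ p) i (coding (c h) ++ Q).
  rewrite count_cat count_P add0n count_p => ->.
  rewrite entry_sizeS_cat -cat_rcons -(size_rcons _ i) entry_sizeS_cat /=.
  case E: coding (gt_c h) => [|y s] /=; last by case/andP.
  by case: ohead lt_Q => //= y; case: ltngtP.
(* Middle letters: the [i] opening [q] is occurrence [h.+1]. It follows the last [i] of [p] directly
   exactly when W_h is empty. *)
move: q_head; rewrite hNk; case: q => //= _ q [->].
rewrite -!catA catA catA /=.
have := nth_positions ((P ++ p) ++ coding (c h)) i (q ++ Q).
rewrite !count_cat count_P count_p (count_memPn (i_notin h)) addn0 add0n => -> /=.
rewrite entry_size_cat entry_sizeS_cat /= !olast_cat.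
case E: coding => [|x s]; first by case: p p_last {count_p} => //= y p ->; rewrite eqxx.
rewrite -E; have [|y -> /= lt_iy] := olast_all _ _ _ (gt_c h); first by rewrite E.
by rewrite E; apply: contraTneq lt_iy => -[->]; rewrite ltnn.
Qed.
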